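(* Let $\mathcal M\subset\mathbb Z^3$ be a minimal subgraph. Then $\mathcal M^3\cup\mathcal M^2$ is minimal, where $\mathcal M^3\cup\mathcal M^2$ denotes (the vertex set of) the union of the 3-skeleton and 2-skeleton of $\mathcal M$, i.e. the set of vertices of $\mathcal M$ that are vertices of some unit square (unit 2-cube) of $\mathbb Z^3$ all four of whose vertices lie in $\mathcal M$.
   Context: $\mathbb Z^n$ is the integer lattice graph: vertices $\mathbb Z^n$, $x\sim y$ iff $|x-y|=1$. For $\Omega\subset\mathbb Z^n$: $\tau\Omega=\{z\notin\Omega:\exists w\in\Omega, z\sim w\}$, $\overline\Omega=\Omega\cup\tau\Omega$, $E_\Omega$ = set of edges $\{x,y\}$ with $x\in\Omega,y\in\overline\Omega$, $\partial K$ = set of edges $\{x,y\}$ with $x\in K$, $y\notin K$. A proper nonempty subset $\mathcal M\subset\mathbb Z^n$ is called minimal (area-minimizing) if for every finite $U\subset\mathbb Z^n$ and every $\hat K\subset\overline U$ with $\hat K\cap\tau U=\mathcal M\cap\tau U$ one has $|\partial\mathcal M\cap E_U|\le|\partial\hat K\cap E_U|$. A subset is identified with its induced subgraph; the $k$-skeleton $\mathcal M^k$ is the union of unit $k$-cubes of $\mathbb R^n$ with integer vertices all of whose vertices lie in $\mathcal M$. *)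

(* Defs.v *)
From HB Require Import structures.
From mathcomp Require Import all_boot all_order all_algebra.
From mathcomp Require Import boolp classical_sets functions cardinality.

Set Implicit Arguments.
Unset Strict Implicit.
Unset Printing Implicit Defensive.

Import Order.TTheory GRing.Theory Num.Theory.
Local Open Scope classical_set_scope.
Local Open Scope ring_scope.
Local Open Scope card_scope.

(* |x - y| = 1 for the Euclidean norm, squared; the l^1 norm gives the same
   relation on integer vectors (the sup norm would not). *)
Definition adj n (x y : 'rV[int]_n) : Prop :=
  \sum_(i < n) (x 0 i - y 0 i) ^+ 2 = 1.

Definition vboundary n (U : set 'rV[int]_n) : set 'rV[int]_n :=
  [set z | ~ U z /\ exists2 w, U w & adj z w].

Definition vclosure n (U : set 'rV[int]_n) : set 'rV[int]_n :=
  U `|` vboundary U.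

(* An edge is the unordered pair of its endpoints, i.e. a two-element set. *)
Definition edges_of n (U : set 'rV[int]_n) : set (set 'rV[int]_n) :=
  [set e | exists x y, [/\ U x, vclosure U y, adj x y & e = [set x; y]]].

Definition eboundary n (K : set 'rV[int]_n) : set (set 'rV[int]_n) :=
  [set e | exists x y, [/\ K x, ~ K y, adj x y & e = [set x; y]]].

(* For finite U the set edges_of U is finite, so #<= compares the numbers of
   elements of two finite sets. *)
Definition area_minimizing n (M : set 'rV[int]_n) : Prop :=
  [/\ M !=set0, M <> setT &
    forall U : set 'rV[int]_n, finite_set U ->
    forall K : set 'rV[int]_n, K `<=` vclosure U ->
      K `&` vboundary U = M `&` vboundary U ->
      eboundary M `&` edges_of U #<= eboundary K `&` edges_of U].

(* The vertices of the unit cube z + [0,1]^I, of dimension #|I|. *)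
Definition cube_vertices n (z : 'rV[int]_n) (I : {set 'I_n}) :
    set 'rV[int]_n :=
  [set v | forall i, v 0 i = z 0 i \/ (i \in I /\ v 0 i = z 0 i + 1)].

(* The integer points of the k-skeleton of M: those of a closed unit cube are
   exactly its vertices. *)
Definition skeleton_vertices n (k : nat) (M : set 'rV[int]_n) :
    set 'rV[int]_n :=
  [set v | exists z (I : {set 'I_n}),
    [/\ #|I| = k, cube_vertices z I `<=` M & cube_vertices z I v]].

Lemma skeleton_verticesS n k (M : set 'rV[int]_n) :
  skeleton_vertices k.+1 M `<=` skeleton_vertices k M.
Proof.
move=> v [z [I [cI zM vz]]].
have [i iI] : exists i, i \in I by apply/card_gt0P; rewrite cI.
exists (\row_j if j == i then v 0 j else z 0 j), (I :\ i)%SET; split.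
- by apply: eq_add_S; rewrite -cI (cardsD1 i I) iI.
- move=> w wz; apply: zM => j; have := wz j; rewrite !mxE in_setD1.
  case: (eqVneq j i) => [-> [-> | [] //] | _ //]; exact: vz.
- move=> j; rewrite !mxE in_setD1; case: (eqVneq j i) => [_|_]; first by left.
  exact: vz.
Qed.

Lemma skeleton_vertices32E (M : set 'rV[int]_3) :
  skeleton_vertices 3 M `|` skeleton_vertices 2 M = skeleton_vertices 2 M.
Proof. by apply/setUidPr; exact: skeleton_verticesS. Qed.

(* Main.v *)
Require Import Defs.
From HB Require Import structures.
From mathcomp Require Import all_boot all_order all_algebra finmap.
From mathcomp Require Import boolp classical_sets functions cardinality.
From mathcomp Require Import zify.

(* Encode M by the spin s = 1 on M and s = -1 off M: M is minimal iff flipping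
   any finite set of vertices does not lower the number of boundary edges, i.e.
   the sum of s(x) s(y) over the edges xy leaving the set is nonnegative.
   Let x in M lie in no unit square of M.  Testing single vertices and the star
   formed by x and its neighbours in M shows that x has exactly three neighbours
   in M; testing pairs shows that no two such x are adjacent.  Hence deleting
   them all changes no boundary count.  Given a finite flip of the reduced set,
   put back every deleted vertex for which this does not increase the boundary:
   all but finitely many are put back, and the result is a finite flip of M, so
   its boundary is at least that of M. *)

Import Order.TTheory GRing.Theory Num.Theory.
Local Open Scope classical_set_scope.
Local Open Scope ring_scope.
Local Open Scope card_scope.

(** * Cut sums in a finite window of a graph, and re-optimising a cut on an independent set *)

Section Cut.
Set Implicit Arguments.
Unset Strict Implicit.
Variables (T : eqType) (e : rel T) (W : seq T).
Hypothesis e_sym : symmetric e.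

Definition cut (S : pred T) (s : T -> int) : int :=
  \sum_(x <- W | S x) \sum_(y <- W | ~~ S y && e x y) s x * s y.

Variables (A : pred T) (s : T -> int).
Hypothesis A_indep : forall a b, A a -> A b -> ~~ e a b.
Hypothesis A_balanced :
  forall a, a \in W -> A a -> \sum_(y <- W | e a y) s y = 0.

(** Blind to [S] on [A], so it stays fixed while the choice on [A] is optimised. *)
Let pull (S : pred T) a : int := \sum_(y <- W | [&& S y, ~~ A y & e a y]) s y.

(* Edges between [A] and its complement are grouped by their end in [A]. *)
Lemma cut_indep (S : pred T) (t : T -> int) :
  (forall x, ~~ A x -> t x = s x) ->
  cut S t =
    \sum_(x <- W | S x && ~~ A x)
      \sum_(y <- W | [&& ~~ S y, ~~ A y & e x y]) s x * s y
    + \sum_(a <- W | A a) t a * (if S a then - pull S a else pull S a).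
Proof.
move=> ts; rewrite /cut (bigID A) /= addrC.
have -> : \sum_(x <- W | S x && ~~ A x)
            \sum_(y <- W | ~~ S y && e x y) t x * t y =
    \sum_(x <- W | S x && ~~ A x)
      \sum_(y <- W | [&& ~~ S y, ~~ A y & e x y]) s x * s y
    + \sum_(a <- W | A a && ~~ S a) t a * pull S a.
  under eq_bigr => x /andP[Sx Ax].
    rewrite (bigID A) /= addrC.
    under eq_bigl => y do rewrite -andbA [e x y && _]andbC.
    under eq_bigr => y /and3P[_ Ay _] do rewrite !ts //.
    over.
  rewrite big_split /=; congr (_ + _).
  rewrite (exchange_big_dep (fun a => A a && ~~ S a)) /=; last first.
    by move=> x a _ /andP[/andP[-> _] ->].
  apply: eq_bigr => a /andP[Aa Sa]; rewrite /pull big_distrr /=.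
  apply: eq_big => [x|x /andP[/andP[_ Ax] _]]; last by rewrite ts // mulrC.
  by rewrite Aa Sa /= andbT -andbA e_sym.
rewrite -addrA; congr (_ + _).
rewrite [RHS](bigID S) /= [RHS]addrC; congr (_ + _).
  rewrite [LHS]big_mkcond [RHS]big_mkcond /=; apply: eq_bigr => a _.
  by case: (A a); case: (S a).
rewrite big_seq_cond [RHS]big_seq_cond.
apply: eq_big => [a|a /and3P[aW Sa Aa]]; first by rewrite [S a && _]andbC.
rewrite Sa -big_distrr /=; congr (_ * _).
(* The spins around [a] sum to zero, so its neighbours outside [S] contribute minus those inside:
   hence the sign in the [if]. *)
have := A_balanced aW Aa; rewrite (bigID (fun y => S y)) /= => /eqP.
rewrite addrC addr_eq0 => /eqP.
have AA y : e a y -> ~~ A y by move=> eay; apply/negP => /(A_indep Aa)/negP.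
have -> : \sum_(y <- W | e a y && S y) s y = pull S a.
  apply: eq_bigl => y; case eay: (e a y); last by rewrite !andbF.
  by rewrite AA //= andbT.
move=> <-; apply: eq_big => [y|y /andP[_ /AA /ts//]]; exact: andbC.
Qed.

Hypothesis sA : forall a, A a -> s a = 1.

(* [S'] is the cheapest choice on [A] among the sets agreeing with [S] off
   [A]: each [a] in [A] can be optimised separately. *)
Lemma cut_flip_indep (S : pred T) :
  let s' x := if A x then -1 else s x in
  exists2 S' : pred T, (forall x, S' x -> S x || A x) & cut S' s <= cut S s'.
Proof.
(* For [a] in [S], flipping from spin -1 costs [pull S a], the same as leaving spin 1 alone. For [a]
   off [S], staying at -1 costs [- pull S a]; starting from 1, a flip costs [- pull S a] and no flip
   costs [pull S a]. *)
move=> s'; pose S' x := if A x then ~~ S x && (0 < pull S x) else S x.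
have S'E x : ~~ A x -> S' x = S x by rewrite /S' => /negPf->.
have pullE a : pull S' a = pull S a.
  apply: eq_bigl => y; case: (boolP (A y)) => [|/S'E-> //].
  by rewrite !andbF.
exists S' => [x|]; first by rewrite /S'; case: (A x) => [_|->//]; exact: orbT.
rewrite (@cut_indep S' s) // (@cut_indep S s'); last first.
  by move=> x /negPf Ax; rewrite /s' Ax.
apply: lerD.
  rewrite le_eqVlt; apply/orP; left; apply/eqP.
  apply: eq_big => [x|x _].
    by case: (boolP (A x)) => [|/S'E-> //]; rewrite !andbF.
  apply: eq_bigl => y.
  by case: (boolP (A y)) => [|/S'E-> //]; rewrite !andbF.
apply: ler_sum => a Aa; rewrite pullE sA // /s' Aa /S' Aa.
by case: (S a) => /=; case: ltrP => h /=; lia.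
Qed.

End Cut.

(** * Lattice neighbours, and the change of the boundary under a finite flip *)

Section Lattice.
Set Implicit Arguments.
Unset Strict Implicit.
Variable n : nat.
Implicit Types (x y : 'rV[int]_n) (M K U : set 'rV[int]_n).
Implicit Types S : seq 'rV[int]_n.

Definition dir (p : 'I_n * bool) : 'rV[int]_n := (-1) ^+ p.2 *: delta_mx 0 p.1.

Definition nbrs x : seq 'rV[int]_n := [seq x + dir p | p : 'I_n * bool].

Lemma dirE (p : 'I_n * bool) i : dir p 0 i = (-1) ^+ p.2 * (i == p.1)%:R.
Proof. by rewrite !mxE eqxx. Qed.

Lemma dir_inj : injective dir.
Proof.
move=> [i b] [j c] /rowP /[dup] /(_ j) + /(_ i); rewrite !dirE /= !eqxx.
by case: eqVneq => [->|_]; case: b; case: c.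
Qed.

Lemma dir_opp (i : 'I_n) b : dir (i, ~~ b) = - dir (i, b).
Proof. by rewrite /dir /= -scaleNr; case: b; rewrite ?opprK. Qed.

Lemma nbrs_uniq x : uniq (nbrs x).
Proof.
by rewrite map_inj_uniq ?enum_uniq// => p q /addrI; exact: dir_inj.
Qed.

Lemma sum_nbrs x (F : 'rV[int]_n -> int) :
  \sum_(y <- nbrs x) F y = \sum_p F (x + dir p).
Proof. by rewrite /nbrs big_image. Qed.

Lemma sum_dir p : \sum_i dir p 0 i = (-1) ^+ p.2.
Proof.
rewrite (bigD1 p.1) //= dirE eqxx mulr1 big1 ?addr0// => i /negPf ip.
by rewrite dirE ip mulr0.
Qed.

Lemma mem_nbrsP x y : reflect (exists p, y = x + dir p) (y \in nbrs x).
Proof.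
by rewrite /nbrs; apply: (iffP fintype.imageP) => [[p _ ->]|[p ->]]; exists p.
Qed.

Lemma nbrs_sym x y : (y \in nbrs x) = (x \in nbrs y).
Proof.
by apply/mem_nbrsP/mem_nbrsP => -[[i b] ->]; exists (i, ~~ b);
  rewrite dir_opp addrK.
Qed.

(** The coordinate sum changes by 1 or -1 along each edge, and such a sign is never the sum of two
    others; so there are no triangles. *)
Lemma nbrs_bipartite x y z : y \in nbrs x -> z \in nbrs x -> z \notin nbrs y.
Proof.
move=> /mem_nbrsP[p ->] /mem_nbrsP[q ->]; apply/mem_nbrsP => -[r].
rewrite -addrA => /addrI/(congr1 (fun v : 'rV_n => \sum_i v 0 i)).
under [RHS]eq_bigr do rewrite mxE.
rewrite big_split /= !sum_dir.
by case: p.2; case: q.2; case: r.2.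
Qed.

Lemma nbrs_irrefl x : x \notin nbrs x.
Proof.
by apply/negP => xx; have := nbrs_bipartite xx xx; rewrite xx.
Qed.

Lemma adjP x y : adj x y <-> y \in nbrs x.
Proof.
split=> [xy|/mem_nbrsP[p ->]]; last first.
  rewrite /adj (bigD1 p.1) //= big1 => [|i /negPf ip].
    rewrite mxE dirE eqxx mulr1 addr0 opprD addNKr sqrrN.
    by rewrite -exprM mulnC exprM sqrrN !expr1n.
  by rewrite mxE dirE ip mulr0 addr0 subrr expr0n.
have [i xyi] : exists i, x 0 i != y 0 i.
  apply/existsP; apply: contra_eqT xy; rewrite negb_exists => /forallP xy.
  rewrite big1 // => i _.
  by have := xy i; rewrite negbK => /eqP ->; rewrite subrr expr0n.
move: xy; rewrite /adj (bigD1 i) //= => xy.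
have rest_ge0 : 0 <= \sum_(j < n | j != i) (x 0 j - y 0 j) ^+ 2.
  by apply: sumr_ge0 => j _; exact: sqr_ge0.
have rest0 : \sum_(j < n | j != i) (x 0 j - y 0 j) ^+ 2 = 0.
  (* The square at [i] is a positive integer, hence at least 1, and uses up the whole sum. *)
  move: xyi rest_ge0 xy; set r := \sum_(_ < _ | _) _; rewrite expr2; nia.
have xyj j : j != i -> y 0 j = x 0 j.
  move=> ji; have := psumr_eq0P (fun j _ => sqr_ge0 (x 0 j - y 0 j)) rest0 ji.
  by move/eqP; rewrite sqrf_eq0 subr_eq0 => /eqP.
move/eqP: xy; rewrite rest0 addr0 sqrf_eq1 => xyi1.
apply/mem_nbrsP.
case/orP: xyi1 => /eqP xyi1; [exists (i, true)|exists (i, false)];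
  by apply/rowP => j; rewrite mxE dirE /=; case: eqVneq => [->|/xyj->]; lia.
Qed.

Lemma adj_sym x y : adj x y -> adj y x.
Proof. by rewrite !adjP nbrs_sym. Qed.

Definition spin M x : int := if x \in M then 1 else -1.

(* The number of edges that flipping the membership in [M] of all points of
   [S] adds to the boundary, minus the number of edges that it removes. *)
Definition flip_cost M S : int :=
  \sum_(x <- S) \sum_(y <- nbrs x | y \notin S) spin M x * spin M y.

Lemma edge_inj x y (x' y' : 'rV[int]_n) :
  [set x; y] = [set x'; y'] -> x = x' /\ y = y' \/ x = y' /\ y = x'.
Proof.
move=> E.
have : [set x'; y'] x by rewrite -E; left.
have : [set x'; y'] y by rewrite -E; right.
have : [set x; y] x' by rewrite E; left.
have : [set x; y] y' by rewrite E; right.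
by case=> e1; case=> e2; case=> e3; case=> e4; subst; auto.
Qed.

Lemma eboundaryP K x y :
  adj x y -> eboundary K [set x; y] <-> (x \in K) != (y \in K).
Proof.
move=> xy; split=> [[x' [y' [Kx Ky _ /edge_inj]]]|].
  by case=> -[-> ->]; rewrite (mem_set Kx) (memNset Ky).
case: (boolP (x \in K)) => Kx; case: (boolP (y \in K)) => Ky // _.
  by exists x, y; split => //; [rewrite inE in Kx|rewrite notin_setE in Ky].
exists y, x; split => //; [by rewrite inE in Ky|by rewrite notin_setE in Kx| |].
  exact: adj_sym.
by rewrite setUC.
Qed.

(** The intersection of [X] and [Y] cancels from both cardinalities. *)
Lemma card_le_setD (T : choiceType) (X Y : set T) (s t : seq T) :
  finite_set X -> finite_set Y -> uniq s -> uniq t ->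
  X `\` Y = [set` s] -> Y `\` X = [set` t] ->
  (X #<= Y) = (size s <= size t)%N.
Proof.
move=> fX fY us ut XY YX.
have card_le : (X #<= Y) = (#|` fset_set X| <= #|` fset_set Y|)%N.
  have cardE (Z : set T) : finite_set Z -> Z #= `I_#|` fset_set Z|.
    by move=> fZ; rewrite -{1}(fset_setK fZ); apply/card_eq_fsetP.
  by rewrite (card_le_eql (cardE _ fX)) (card_le_eqr (cardE _ fY)) card_le_II.
have card_seq (u : seq T) : uniq u -> #|` fset_set [set` u]| = size u.
  move=> uu; have -> : fset_set [set` u] = [fset x in u]%fset.
    apply/fsetP => x; rewrite in_fset_set ?finite_seq// !inE.
    by apply/idP/idP; rewrite inE.
  by rewrite card_fseq undup_id.
rewrite card_le -(cardfsID (fset_set Y) (fset_set X)).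
rewrite -(cardfsID (fset_set X) (fset_set Y)) fsetIC leq_add2l.
by rewrite -!fset_setD// XY YX !card_seq.
Qed.

Let edge (p : 'rV[int]_n * 'rV[int]_n) := [set p.1; p.2].

(** Edges leaving [S] are oriented outwards, so that each unordered edge is listed once when [S] has
    no repetitions. *)
Let crossing S :=
  [seq p <- [seq (x, y) | x <- S, y <- nbrs x] | p.2 \notin S].

Let mem_crossing S x y :
  ((x, y) \in crossing S) = [&& x \in S, y \in nbrs x & y \notin S].
Proof.
rewrite mem_filter andbC /= andbA; congr (_ && _).
apply/allpairsPdep/andP => [[a [b [aS ab [-> ->]]]] //|[xS xy]].
by exists x, y.
Qed.

Let crossing_uniq S : uniq S -> uniq (crossing S).
Proof.
move=> uS; apply: filter_uniq; apply: allpairs_uniq_dep => //.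
  by move=> x _; exact: nbrs_uniq.
by move=> [a b] [c d] _ _ /= [-> ->].
Qed.

Let edge_inj_crossing S : {in crossing S &, injective edge}.
Proof.
move=> [x y] [x' y']; rewrite !mem_crossing.
move=> /and3P[xS _ yS] /and3P[x'S _ y'S] /edge_inj /= [[-> ->] //|[xy _]].
by move: y'S; rewrite -xy xS.
Qed.

(** An edge leaving [S] joins the boundary after the flip when its ends agree, contributing 1, and
    drops out of it otherwise, contributing -1. *)
Let flip_costE M S : flip_cost M S =
  (count (fun p => (p.1 \in M) == (p.2 \in M)) (crossing S))%:Z
  - (count (fun p => (p.1 \in M) != (p.2 \in M)) (crossing S))%:Z.
Proof.
have -> : flip_cost M S = \sum_(p <- crossing S) spin M p.1 * spin M p.2.
  rewrite /crossing big_filter big_mkcond big_allpairs_dep /=.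
  by apply: eq_bigr => x _; rewrite big_mkcond.
rewrite (bigID (fun p => (p.1 \in M) == (p.2 \in M))) /=; congr (_ + _).
  rewrite (eq_bigr (fun=> 1)); last first.
    by move=> p; rewrite /spin; case: ifP; case: ifP.
  by rewrite big_const_seq iter_addr addr0 -mulr_natl mulr1 natz.
rewrite (eq_bigr (fun=> - 1)); last first.
  by move=> p; rewrite /spin; case: ifP; case: ifP.
by rewrite sumrN big_const_seq iter_addr addr0 -mulr_natl mulr1 natz.
Qed.

Lemma finite_edges_of U : finite_set U -> finite_set (edges_of U).
Proof.
move=> /finite_seqP[s ->].
apply: (@sub_finite_set _ _
  (edge @` [set` [seq (x, y) | x <- s, y <- nbrs x]])).
  move=> e [x [y [xs _ /adjP xy ->]]]; exists (x, y) => //=.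
  by apply/allpairsPdep; exists x, y.
exact/finite_image/finite_seq.
Qed.

(** Flipping [S] toggles the boundary status of exactly the edges with one end in [S], so the two
    set differences of the boundaries are the two kinds of crossing edges. *)
Lemma flip_costP M K U S : finite_set U -> uniq S -> {in S, forall x, U x} ->
    (forall x, vclosure U x -> (x \in K) = (x \in M) (+) (x \in S)) ->
  (eboundary M `&` edges_of U #<= eboundary K `&` edges_of U)
    = (0 <= flip_cost M S).
Proof.
move=> fU uS SU KE.
have crossE e : edges_of U e -> eboundary M e <> eboundary K e ->
    exists2 p, p \in crossing S & e = edge p.
  move=> [x [y [Ux Uy xy ->]]] MK.
  have {MK} : (x \in S) != (y \in S).
    apply: contra_notN MK => /eqP xyS; apply/propext.
    by rewrite !eboundaryP// !KE//; [rewrite xyS|left]; case: (_ \in S);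
      rewrite ?addbT ?addbF// (inj_eq negb_inj).
  case: (boolP (x \in S)) (boolP (y \in S)) => xS [] yS // _.
    by exists (x, y) => //; rewrite mem_crossing xS yS andbT; exact/adjP.
  exists (y, x); last exact: setUC.
  by rewrite mem_crossing xS yS andbT; apply/adjP/adj_sym.
have crossP p : p \in crossing S ->
  [/\ edges_of U (edge p), eboundary M (edge p) <-> (p.1 \in M) != (p.2 \in M)
    & eboundary K (edge p) <-> (p.1 \in M) == (p.2 \in M)].
  case: p => x y; rewrite mem_crossing => /and3P[xS xy yS].
  have Ux := SU _ xS; have axy : adj x y by apply/adjP.
  have Uy : vclosure U y.
    have [Uy|Uy] := pselect (U y); [by left|right; split=> //].
    by exists x => //; exact: adj_sym.
  split; [by exists x, y|exact: eboundaryP|].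
  rewrite eboundaryP// !KE//; last by left.
  by rewrite xS (negPf yS) /=; case: (x \in M); case: (y \in M).
set d := fun p : 'rV_n * 'rV_n => (p.1 \in M) != (p.2 \in M).
rewrite (@card_le_setD _ _ _ [seq edge p | p <- crossing S & d p]
           [seq edge p | p <- crossing S & ~~ d p]).
- rewrite !size_map !size_filter flip_costE subr_ge0 lez_nat.
  by congr (_ <= _)%N; apply: eq_count => p; rewrite /d /= ?negbK.
- exact/finite_setIr/finite_edges_of.
- exact/finite_setIr/finite_edges_of.
- rewrite map_inj_in_uniq; first exact/filter_uniq/crossing_uniq.
  exact/(sub_in2 _ (@edge_inj_crossing S))/mem_subseq/filter_subseq.
- rewrite map_inj_in_uniq; first exact/filter_uniq/crossing_uniq.
  exact/(sub_in2 _ (@edge_inj_crossing S))/mem_subseq/filter_subseq.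
- apply/seteqP; split=> [e [[Me Ue] nKe]|e /= /mapP[p]].
    have [|p pS ep] := crossE e Ue.
      by move=> MK; apply: nKe; split; rewrite -?MK.
    apply/mapP; exists p => //; rewrite mem_filter pS andbT.
    by have [_ + _] := crossP _ pS; rewrite -ep => -[/(_ Me)].
  rewrite mem_filter => /andP[dp /crossP[Up Mp Kp]] ->.
  split; first by split=> //; exact/Mp.
  by move=> [/Kp Kd _]; move: dp; rewrite /d Kd.
- apply/seteqP; split=> [e [[Ke Ue] nMe]|e /= /mapP[p]].
    have [|p pS ep] := crossE e Ue.
      by move=> MK; apply: nMe; split; rewrite ?MK.
    apply/mapP; exists p => //; rewrite mem_filter pS andbT /d negbK.
    by have [_ _] := crossP _ pS; rewrite -ep => -[/(_ Ke)].
  rewrite mem_filter /d negbK => /andP[dp /crossP[Up Mp Kp]] ->.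
  split; first by split=> //; exact/Kp.
  by move=> [/Mp]; rewrite dp.
Qed.

(* Equivalently, [spin M] is a ground state of the ferromagnetic Ising model. *)
Lemma area_minimizingP M : area_minimizing M <->
  [/\ M !=set0, M <> setT & forall S, uniq S -> 0 <= flip_cost M S].
Proof.
split=> -[M0 MT minM]; split=> //.
  move=> S uS; pose U := [set` S].
  pose K := [set x | vclosure U x /\ (x \in M) (+) (x \in S)].
  have fU : finite_set U := finite_seq S.
  rewrite -(@flip_costP M K U)//; last first.
    by move=> x Ux; apply/idP/idP; rewrite inE => // -[].
  apply: minM => //; first by move=> x [].
  apply/seteqP; split=> x [xM [xU xb]]; split=> //.
    by case: xM => _; rewrite (negPf (introN idP xU)) addbF inE.
  by split; [right|rewrite (negPf (introN idP xU)) addbF inE].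
move=> U fU K KU KM; have /finite_seqP[s Us] := fU.
(* A competitor is a flip of its symmetric difference with [M] inside [U]; on the vertex boundary of
   [U] the two sets agree. *)
pose S := undup [seq x <- s | (x \in M) (+) (x \in K)].
have memS x : (x \in S) = (x \in s) && ((x \in M) (+) (x \in K)).
  by rewrite mem_undup mem_filter andbC.
rewrite (@flip_costP M K U S)//; first exact/minM/undup_uniq.
- exact: undup_uniq.
- by move=> x; rewrite memS Us => /andP[].
move=> x [Ux|xb].
  rewrite memS; have -> : x \in s by move: Ux; rewrite Us.
  by rewrite addbA addbb.
have -> : (x \in S) = false.
  by apply/negbTE; rewrite memS; case: xb; rewrite Us /= => /negP/negPf->.
have /(congr1 (fun A => A x)) := KM; rewrite addbF => KMx.
apply/idP/idP; rewrite !inE => xM.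
  by have [] : (M `&` vboundary U) x by rewrite -KMx.
by have [] : (K `&` vboundary U) x by rewrite KMx.
Qed.

End Lattice.

(** * Linear inequalities on the star of a vertex in dimension 3 *)

Lemma sum_dirs3 (F : 'I_3 * bool -> int) :
  let i0 : 'I_3 := ord0 in let i1 : 'I_3 := lift ord0 ord0 in
  let i2 : 'I_3 := lift ord0 (lift ord0 ord0) in
  \sum_p F p = F (i0, true) + F (i0, false) + F (i1, true) + F (i1, false)
               + F (i2, true) + F (i2, false).
Proof.
move=> i0 i1 i2; rewrite (eq_bigr (fun p => F (p.1, p.2))); last by case.
rewrite -(pair_bigA _ (fun i b => F (i, b))) /=.
by rewrite !big_ord_recl big_ord0 !big_bool /= addr0 !addrA.
Qed.

(* [b p] says whether the neighbour in direction [p] is occupied and [g p q] is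
   the spin two steps away, along [p] and [q].  For each occupancy of the six
   neighbours the constraints on [g] are linear and refute degree 4 or more. *)
Lemma star_degree (b : pred ('I_3 * bool))
    (g : 'I_3 * bool -> 'I_3 * bool -> int) :
    (forall p q, -1 <= g p q <= 1) ->
    (forall p q, g p q = g q p) ->
    (forall i c, g (i, c) (i, ~~ c) = 1) ->
    (forall p q, p.1 != q.1 -> b p -> b q -> g p q = -1) ->
    (forall p, ~~ b p -> \sum_q g p q <= 0) ->
    6 <= \sum_(p | b p) \sum_q g p q ->
  \sum_p (if b p then 1 else -1) <= 0 :> int.
Proof.
move=> bnd sym antip perp off; rewrite big_mkcond !sum_dirs3 /=.
set i0 : 'I_3 := ord0; set i1 : 'I_3 := lift ord0 ord0.
set i2 : 'I_3 := lift ord0 (lift ord0 ord0).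
(* As boolean implications, the constraints are switched on or off by the case split on [b]. *)
have perp' i j c d (ij : i != j) :
    b (i, c) && b (j, d) ==> (g (i, c) (j, d) == -1).
  by apply/implyP => /andP[bi bj]; apply/eqP/perp.
have off' p : ~~ b p ==> (\sum_q g p q <= 0) by apply/implyP/off.
move: (off' (i0, true)) (off' (i0, false)) (off' (i1, true)) (off' (i1, false))
   (off' (i2, true)) (off' (i2, false)).
have i01 : i0 != i1 by []. have i02 : i0 != i2 by []. have i12 : i1 != i2 by [].
move: (perp' _ _ true true i01) (perp' _ _ true false i01)
  (perp' _ _ false true i01) (perp' _ _ false false i01)
  (perp' _ _ true true i02) (perp' _ _ true false i02)
  (perp' _ _ false true i02) (perp' _ _ false false i02)
  (perp' _ _ true true i12) (perp' _ _ true false i12)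
  (perp' _ _ false true i12) (perp' _ _ false false i12).
(* Symmetry and backtracking leave 18 unknowns: 6 straight and 12 perpendicular ones. *)
rewrite !sum_dirs3 -/i0 -/i1 -/i2 !(sym (i1, _) (i0, _)) !(sym (i2, _) (i0, _)).
rewrite !(sym (i2, _) (i1, _)) !(antip _ true) !(antip _ false).
have B i c j d : -1 <= g (i, c) (j, d) <= 1 by exact: bnd.
move: (B i0 true i0 true) (B i0 false i0 false) (B i1 true i1 true)
  (B i1 false i1 false) (B i2 true i2 true) (B i2 false i2 false)
  (B i0 true i1 true) (B i0 true i1 false) (B i0 false i1 true)
  (B i0 false i1 false) (B i0 true i2 true) (B i0 true i2 false)
  (B i0 false i2 true) (B i0 false i2 false) (B i1 true i2 true)
  (B i1 true i2 false) (B i1 false i2 true) (B i1 false i2 false).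
(* For instance, with four occupied directions and two opposite empty ones, each empty row bounds
   its perpendicular terms by 0, so the occupied rows total at most 0 instead of 6. *)
case: (b (i0, true)); case: (b (i0, false)); case: (b (i1, true));
  case: (b (i1, false)); case: (b (i2, true)); case: (b (i2, false)) => /=.
all: lia.
Qed.

(** * Local inequalities from flipping a vertex, an adjacent pair and a star *)

Section GroundState.
Set Implicit Arguments.
Unset Strict Implicit.
Variables (n : nat) (M : set 'rV[int]_n).
Hypothesis ground : forall S, uniq S -> 0 <= flip_cost M S.
Implicit Types x y : 'rV[int]_n.

(** In dimension 3 this is twice the number of neighbours in [M], minus 6: it vanishes iff exactly
    three neighbours lie in [M]. *)
Definition field x : int := \sum_(y <- nbrs x) spin M y.

Let spin1 x : x \in M -> spin M x = 1.
Proof. by rewrite /spin => ->. Qed.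

Let spinN1 x : x \notin M -> spin M x = -1.
Proof. by rewrite /spin => /negPf->. Qed.

Let sum1z (T : Type) (s : seq T) (P : pred T) :
  \sum_(y <- s | P y) 1 = (count P s)%:Z.
Proof. by rewrite big_const_seq iter_addr addr0 -mulr_natl mulr1 natz. Qed.

(** Test on the flip of [x] alone; no vertex is its own neighbour. *)
Lemma spin_field_ge0 x : 0 <= spin M x * field x.
Proof.
have := ground (isT : uniq [:: x]); rewrite /flip_cost big_seq1 -big_distrr /=.
suff -> : \sum_(y <- nbrs x | y \notin [:: x]) spin M y = field x by [].
rewrite /field big_seq_cond [RHS]big_seq_cond; apply: eq_bigl => y; rewrite inE.
by case: eqVneq => [->|]; rewrite ?andbT// (negPf (nbrs_irrefl x)).
Qed.

Lemma field_ge0 x : x \in M -> 0 <= field x.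
Proof. by move=> xM; have := spin_field_ge0 x; rewrite spin1// mul1r. Qed.

Lemma field_le0 x : x \notin M -> field x <= 0.
Proof.
by move=> xM; have := spin_field_ge0 x; rewrite spinN1// mulN1r oppr_ge0.
Qed.

Let field_out x y (S : seq 'rV[int]_n) : x \in nbrs y ->
    {in nbrs y, forall z, (z \in S) = (z == x)} ->
  \sum_(z <- nbrs y | z \notin S) spin M z = field y - spin M x.
Proof.
move=> xy zS; rewrite /field [X in _ = X - _](bigD1_seq x) ?nbrs_uniq//=.
rewrite addrAC subrr add0r big_seq_cond [RHS]big_seq_cond.
by apply: eq_bigl => z; case: (boolP (z \in nbrs y)) => //= /zS->.
Qed.

(** When both vertices are flipped the edge between them does not count, so each field loses 1. *)
Lemma field_pair x y :
  x \in M -> y \in M -> y \in nbrs x -> 2 <= field x + field y.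
Proof.
move=> xM yM xy; have yx : x \in nbrs y by rewrite nbrs_sym.
have neq : x != y by apply: contraTneq xy => ->; exact: nbrs_irrefl.
have uS : uniq [:: x; y] by rewrite /= inE neq.
have := ground uS; rewrite /flip_cost big_cons big_seq1 -!big_distrr /=.
rewrite (field_out xy) ?(field_out yx) ?spin1//; first lia.
- move=> z zy; rewrite !inE; case: (eqVneq z y) zy => [->|]; rewrite ?orbF//.
  by rewrite (negPf (nbrs_irrefl y)).
- move=> z zx; rewrite !inE; case: (eqVneq z x) zx => [->|]//.
  by rewrite (negPf (nbrs_irrefl x)).
Qed.

(** Flip [x] with its neighbours in [M]. Each empty neighbour of [x] contributes -1; each occupied
    one contributes its field minus 1, since without triangles [x] is its only neighbour in the
    flipped set. *)
Lemma field_star x : x \in M ->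
  (size (nbrs x))%:Z <= \sum_(y <- nbrs x | y \in M) field y.
Proof.
move=> xM; pose D := [seq y <- nbrs x | y \in M].
have xD : x \notin D by rewrite mem_filter negb_and nbrs_irrefl orbT.
have uS : uniq (x :: D) by rewrite /= xD filter_uniq ?nbrs_uniq.
have := ground uS; rewrite /flip_cost big_cons -big_distrr /=.
have -> : \sum_(y <- nbrs x | y \notin x :: D) spin M y =
          - (count (predC (fun y => y \in M)) (nbrs x))%:Z.
  rewrite -sum1z -sumrN.
  rewrite big_seq_cond [RHS]big_seq_cond.
  apply: eq_big => [y|y /andP[yx]]; rewrite inE mem_filter.
    case: (boolP (y \in nbrs x)) => //= yx; rewrite andbT negb_or.
    by case: eqVneq yx => // ->; rewrite (negPf (nbrs_irrefl x)).
  by rewrite yx andbT negb_or => /andP[_ /spinN1].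
have -> : \sum_(y <- D) \sum_(z <- nbrs y | z \notin x :: D)
            spin M y * spin M z = \sum_(y <- nbrs x | y \in M) (field y - 1).
  rewrite /D big_filter big_seq_cond [RHS]big_seq_cond.
  apply: eq_bigr => y /andP[yx yM]; rewrite -big_distrr spin1//= mul1r.
  rewrite (@field_out x) ?spin1 1?nbrs_sym// => z zy.
  rewrite inE mem_filter; case: eqVneq => //= _.
  case: (boolP (z \in nbrs x)) => [zx|]; last by rewrite andbF.
  by have := nbrs_bipartite yx zx; rewrite zy.
rewrite -(count_predC (fun y => y \in M)) spin1// mul1r big_split /= sumrN.
have -> : \sum_(y <- nbrs x | y \in M) 1 =
          (count (fun y => y \in M) (nbrs x))%:Z.
  exact: sum1z.
rewrite PoszD; set f := \sum_(_ <- _ | _) _; lia.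
Qed.

End GroundState.

(** * Deleting vertices of zero field preserves the ground state *)

Section Removal.
Set Implicit Arguments.
Unset Strict Implicit.
Variables (n : nat) (M A : set 'rV[int]_n).
Hypothesis ground : forall S, uniq S -> 0 <= flip_cost M S.
Hypothesis AM : A `<=` M.
Hypothesis A_free : forall a, A a -> field M a = 0.

Let e : rel 'rV[int]_n := fun x y => y \in nbrs x.

Lemma free_indep a b : A a -> A b -> b \notin nbrs a.
Proof.
move=> Aa Ab; apply/negP.
move=> /(field_pair ground (mem_set (AM Aa)) (mem_set (AM Ab))).
by rewrite !A_free.
Qed.

(** Once [W] contains [S] and its neighbours, restricting to the window loses no edge leaving
    [S]. *)
Let cutE (W S : seq 'rV[int]_n) (t : 'rV[int]_n -> int) :
    uniq W -> uniq S -> {subset S <= W} ->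
    (forall x y, x \in S -> y \in nbrs x -> y \in W) ->
  \sum_(x <- S) \sum_(y <- nbrs x | y \notin S) t x * t y
    = cut e W (fun x => x \in S) t.
Proof.
move=> uW uS SW nSW; rewrite /cut -[RHS]big_filter.
rewrite -(perm_big _ (uniq_perm uS (filter_uniq (fun x => x \in S) uW) _)) /=.
  rewrite big_seq [RHS]big_seq; apply: eq_bigr => x xS.
  rewrite -[LHS]big_filter -[RHS]big_filter; apply: perm_big.
  apply: uniq_perm; rewrite ?filter_uniq ?nbrs_uniq// => y.
  rewrite !mem_filter -andbA; congr (_ && _).
  by apply/idP/andP => [yx|[]//]; split=> //; exact: nSW yx.
move=> x; rewrite mem_filter; apply/idP/andP => [xS|[]//].
by split=> //; exact: SW.
Qed.

(** Near [S], deleting [A] is the change of spins in [cut_flip_indep], whose [S'] is a finite flip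
    of [M]. *)
Lemma flip_cost_setD S : uniq S -> 0 <= flip_cost (M `\` A) S.
Proof.
move=> uS; pose cl (s : seq 'rV[int]_n) := s ++ flatten [seq nbrs x | x <- s].
have cl_sub s : {subset s <= cl s} by move=> x xs; rewrite mem_cat xs.
have cl_nbrs s x y : x \in s -> y \in nbrs x -> y \in cl s.
  move=> xs xy; rewrite mem_cat; apply/orP; right.
  by apply/flattenP; exists (nbrs x) => //; exact: map_f.
(* [S'] may reach one layer beyond [S], and balance needs all neighbours of that layer: hence two
   closures. Deletions outside [cl S] do not affect the cost of [S], so [B] can replace [A]. *)
pose W := undup (cl (cl S)); pose B x := (x \in A) && (x \in cl S).
have uW : uniq W by exact: undup_uniq.
have clW x : x \in cl S -> x \in W by rewrite mem_undup; exact: cl_sub.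
have nclW x y : x \in cl S -> y \in nbrs x -> y \in W.
  by rewrite mem_undup; exact: cl_nbrs.
have e_sym : symmetric e by move=> x y; exact: nbrs_sym.
have B_indep a b : B a -> B b -> ~~ e a b.
  by move=> /andP[/set_mem Aa _] /andP[/set_mem Ab _]; exact: free_indep.
have B_balanced a : a \in W -> B a -> \sum_(y <- W | e a y) spin M y = 0.
  move=> _ /andP[/set_mem Aa aS].
  rewrite -[RHS](A_free Aa) /field -[LHS]big_filter.
  apply: perm_big; apply: uniq_perm; rewrite ?filter_uniq ?nbrs_uniq// => y.
  rewrite mem_filter; apply/andP/idP => [[]//|ay].
  by split=> //; exact: nclW ay.
have B_spin a : B a -> spin M a = 1.
  by move=> /andP[/set_mem/AM/mem_set Ma _]; rewrite /spin Ma.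
have [S' S'sub] :=
  cut_flip_indep e_sym B_indep B_balanced B_spin (fun x => x \in S).
have S'cl x : S' x -> x \in cl S by move=> /S'sub/orP[/cl_sub//|/andP[]].
have -> : flip_cost (M `\` A) S =
    cut e W (fun x => x \in S) (fun x => if B x then -1 else spin M x).
  have spinD x : x \in cl S ->
      spin (M `\` A) x = if B x then -1 else spin M x.
    move=> xS; rewrite /spin /B xS andbT in_setD.
    by case: (x \in A); rewrite ?andbF ?andbT.
  rewrite -cutE//; last 2 first.
  - by move=> x xS; exact/clW/cl_sub.
  - by move=> x y xS; exact/nclW/cl_sub.
  rewrite /flip_cost big_seq [RHS]big_seq; apply: eq_bigr => x xS.
  rewrite big_seq_cond [RHS]big_seq_cond; apply: eq_bigr => y /andP[xy _].
  by rewrite !spinD//; [exact: cl_nbrs xy|exact: cl_sub].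
(* Listing [S'] as [T] makes it a flip to which [ground] applies. *)
apply: le_trans; pose T := [seq x <- W | S' x].
have -> : S' = (fun x => x \in T).
  apply/funext => x; rewrite mem_filter; case S'x : (S' x) => //=.
  by apply/esym/clW/S'cl.
rewrite -cutE ?filter_uniq//; first exact/ground/filter_uniq.
- by move=> x; rewrite mem_filter => /andP[].
- by move=> x y; rewrite mem_filter => /andP[/S'cl xS _]; exact: nclW.
Qed.

End Removal.

(** * Unit squares, and vertices of [M] lying in none of them *)

Section Dimension3.
Set Implicit Arguments.
Unset Strict Implicit.
Variable M : set 'rV[int]_3.

Lemma skeleton_vertices2 x (p q : 'I_3 * bool) : p.1 != q.1 -> M x ->
  M (x + dir p) -> M (x + dir q) -> M (x + dir p + dir q) ->
  skeleton_vertices 2 M x.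
Proof.
case: p q => [i c] [j d] /= ij Mx Mp Mq Mpq.
(* The base corner is [x] moved back by 1 along each axis whose direction is negative, which [true]
   marks. *)
exists (\row_k (x 0 k - ((k == i) && c)%:R - ((k == j) && d)%:R)).
exists [set i; j]%SET; split; first by rewrite cards2 ij.
- move=> w wz.
  (* A corner is reached from [x] by either direction, both or neither, according to which
     coordinates changed. *)
  have -> : w = x + (w 0 i != x 0 i)%:R *: dir (i, c)
                  + (w 0 j != x 0 j)%:R *: dir (j, d).
    have := wz i; have := wz j; rewrite !mxE !in_set2 !eqxx orbT [j == i]eq_sym.
    rewrite (negPf ij) /= => wj wi; apply/rowP => k; rewrite !mxE.
    rewrite eqxx /=; case: (eqVneq k i) => [->|ki].
      rewrite (negPf ij) /=.
      by case: eqVneq => [->|]; case: c wi {wz Mp Mpq} => /=; lia.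
    case: (eqVneq k j) => [->|kj].
      by case: (eqVneq (w 0 j)) => [->|]; case: d wj {wz Mq Mpq} => /=; lia.
    have := wz k; rewrite !mxE in_set2 (negPf ki) (negPf kj) /= !mulr0.
    by case=> [->|[]//]; lia.
  by case: eqVneq => _; case: eqVneq => _;
    rewrite ?scale0r ?scale1r ?addr0.
move=> k; rewrite mxE !in_set2.
case: (eqVneq k i) => [->|ki]; first rewrite (negPf ij) /=.
  by case: c {Mp Mpq}; [right; split=> //; lia|left; lia].
case: (eqVneq k j) => [kj|kj] /=; last by left; lia.
by case: d {Mq Mpq}; [right; split=> //; lia|left; lia].
Qed.

Hypothesis ground : forall S, uniq S -> 0 <= flip_cost M S.

(** The single-vertex test gives one inequality and [star_degree] the other. *)
Lemma field_not_skeleton x : M x -> ~ skeleton_vertices 2 M x -> field M x = 0.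
Proof.
move=> Mx nx; have xM := mem_set Mx; apply/eqP.
rewrite eq_le (field_ge0 ground xM) andbT /field sum_nbrs.
apply: (@star_degree (fun p => x + dir p \in M)
                     (fun p q => spin M (x + dir p + dir q))).
- by move=> p q; rewrite /spin; case: ifP.
- by move=> p q; rewrite addrAC.
- by move=> i c; rewrite dir_opp addrK /spin xM.
(* An occupied fourth corner would complete a unit square at [x]. *)
- move=> p q pq /set_mem Mp /set_mem Mq; rewrite /spin memNset// => Mpq.
  exact/nx/skeleton_vertices2/Mpq.
- by move=> p /(field_le0 ground); rewrite /field sum_nbrs.
- have := field_star ground xM.
  rewrite size_map -cardE card_prod card_ord card_bool.
  rewrite big_mkcond sum_nbrs -big_mkcond /=.
  by under eq_bigr do rewrite /field sum_nbrs.
Qed.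

End Dimension3.

Theorem theorem1p9 (M : set 'rV[int]_3) (hM : area_minimizing M) :
  area_minimizing (skeleton_vertices 3 M `|` skeleton_vertices 2 M).
Proof.
rewrite skeleton_vertices32E; set M' := skeleton_vertices 2 M.
have M'M : M' `<=` M by move=> x [z [I [_ + xz]]]; exact.
move/area_minimizingP: hM => [[x Mx] MT ground].
have free a : (M `\` M') a -> field M a = 0.
  by case; exact: field_not_skeleton.
have DM : M `\` M' `<=` M by move=> a [].
apply/area_minimizingP; split.
(* If [M'] were empty, every vertex of [M] would have zero field, so by independence [x] would have
   no neighbour in [M], and its field would be -6. *)
- apply: contrapT => M'0.
  have notM' y : ~ M' y by move=> M'y; apply: M'0; exists y.
  have := free x (conj Mx (notM' x)).
  rewrite /field big_seq (eq_bigr (fun=> - 1)); last first.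
    move=> y xy; rewrite /spin memNset// => My.
    by move: xy; apply/negP/(free_indep ground DM free).
  rewrite -big_seq big_const_seq iter_addr addr0 count_predT.
  by rewrite size_map -cardE card_prod card_ord card_bool.
- move=> M'T; apply: MT; apply/seteqP; split=> // y _.
  by apply: M'M; rewrite M'T.
- have -> : M' = M `\` (M `\` M') by rewrite setDD; apply/esym/setIidr.
  exact: flip_cost_setD.
Qed.
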